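(* Let $\Lambda\subset\mathbb{R}^n$ be an $n$-dimensional unimodular lattice, let $\ell=\lfloor n/8\rfloor$, and let $m_0,\dots,m_\ell\in\mathbb{Q}$ (with $\sum_{r=0}^{\ell}m_r=1$) be the coefficients such that $\Delta_\Lambda(\tau)=\sum_{r=0}^{\ell}m_r\,[h(t(\tau))]^r$ for all $\tau>0$. Put $f_\Lambda(t)=\sum_{r=0}^{\ell}m_r\,h(t)^r$. If $f_\Lambda$ is U-shaped on $[0,1]$ around $1/\sqrt{2}$, then the theta series ratio $\Delta_\Lambda(\tau)$, $\tau>0$, achieves its global minimum at $\tau=1$, and for all $\tau>0$, $$\vartheta_3^n(i\tau)\sum_{r=0}^{\ell}m_r\Bigl(\frac34\Bigr)^r\;\le\;\Theta_\Lambda(i\tau)\;\le\;\vartheta_3^n(i\tau).$$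
   Context: A (full rank) lattice $\Lambda\subset\mathbb{R}^n$ is unimodular if it is equal to its dual lattice $\Lambda^\star$ (in particular it is integral and has volume $1$). For $\tau>0$, the theta series is $\Theta_\Lambda(i\tau)=\sum_{\lambda\in\Lambda}e^{-\pi\tau\|\lambda\|^2}$. The Jacobi theta functions are $\vartheta_3(i\tau)=\sum_{v\in\mathbb{Z}}e^{-\pi\tau v^2}$ and $\vartheta_4(i\tau)=\sum_{v\in\mathbb{Z}}(-1)^v e^{-\pi\tau v^2}$; note $\Theta_{\mathbb{Z}^n}(i\tau)=\vartheta_3^n(i\tau)$. The theta series ratio of a volume-one lattice is $\Delta_\Lambda(\tau)=\Theta_\Lambda(i\tau)/\Theta_{\mathbb{Z}^n}(i\tau)$. Let $h(t)=t^4-t^2+1$ and $t(\tau)=\vartheta_4^2(i\tau)/\vartheta_3^2(i\tau)\in[0,1]$ for $\tau>0$. For every $n$-dimensional unimodular lattice $\Lambda$ there exist rational numbers $m_0,\dots,m_\ell$, $\ell=\lfloor n/8\rfloor$, with $\sum_r m_r=1$ and $\Delta_\Lambda(\tau)=\sum_{r=0}^\ell m_r[h(t(\tau))]^r$ for all $\tau>0$. For any given $t\in(0,1)$ there is a unique $\tau>0$ with $t(\tau)=t$, and $t(1)=1/\sqrt2$. A function $f$ is U-shaped on an interval $[a,b]$ around a point $t_0\in[a,b]$ if its derivative satisfies $f'(t)<0$ for $a<t<t_0$, $f'(t_0)=0$, and $f'(t)>0$ for $t_0<t\le b$. *)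

(* Defs.v *)
From HB Require Import structures.
From mathcomp Require Import all_boot all_order all_algebra archimedean.
From mathcomp Require Import all_classical all_reals all_analysis.

Set Implicit Arguments.
Unset Strict Implicit.
Unset Printing Implicit Defensive.

Import Order.TTheory GRing.Theory Num.Theory.
Import numFieldNormedType.Exports.

Local Open Scope classical_set_scope.
Local Open Scope ring_scope.

(* The unordered sum of an absolutely summable real family, as the sum of its
   positive part minus that of its negative part ([esum] only handles
   nonnegative families). *)
Definition real_sum (R : realType) (I : choiceType) (D : set I) (f : I -> R) : R :=
  fine (\esum_(i in D) (Num.max (f i) 0)%:E) -
  fine (\esum_(i in D) (Num.max (- f i) 0)%:E).

(* The Euclidean structure of R^n; the library norm `|x| on row vectors is the
   sup norm, hence is not used here. *)
Definition dotp (R : realType) (n : nat) (x y : 'rV[R]_n) : R :=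
  \sum_(i < n) x 0 i * y 0 i.

Definition normsq (R : realType) (n : nat) (x : 'rV[R]_n) : R := dotp x x.

(* The lattice of all integer combinations of the rows of B. *)
Definition lattice_of (R : realType) (n : nat) (B : 'M[R]_n) : set 'rV[R]_n :=
  [set map_mx intr z *m B | z in [set: 'rV[int]_n]].

Definition full_rank_lattice (R : realType) (n : nat) (L : set 'rV[R]_n) : Prop :=
  exists2 B : 'M[R]_n, B \in unitmx & L = lattice_of B.

Definition dual_lattice (R : realType) (n : nat) (L : set 'rV[R]_n) : set 'rV[R]_n :=
  [set y | forall x, L x -> dotp x y \is a Num.int].

Definition unimodular_lattice (R : realType) (n : nat) (L : set 'rV[R]_n) : Prop :=
  full_rank_lattice L /\ L = dual_lattice L.

Definition Zlattice (R : realType) (n : nat) : set 'rV[R]_n :=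
  lattice_of 1%:M.

(* Theta functions are considered on the positive imaginary axis only: the
   argument tau of the following functions stands for the point i tau. *)
Definition lattice_theta (R : realType) (n : nat) (L : set 'rV[R]_n) (tau : R) : R :=
  real_sum L (fun x => expR (- pi * tau * normsq x)).

Definition theta3 (R : realType) (tau : R) : R :=
  real_sum [set: int] (fun v => expR (- pi * tau * v%:~R ^+ 2)).

Definition theta4 (R : realType) (tau : R) : R :=
  real_sum [set: int] (fun v => (-1) ^ v * expR (- pi * tau * v%:~R ^+ 2)).

Definition theta_ratio (R : realType) (n : nat) (L : set 'rV[R]_n) (tau : R) : R :=
  lattice_theta L tau / lattice_theta (@Zlattice R n) tau.

Definition hpoly (R : realType) (t : R) : R := t ^+ 4 - t ^+ 2 + 1.

Definition tparam (R : realType) (tau : R) : R :=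
  theta4 tau ^+ 2 / theta3 tau ^+ 2.

Definition f_of_coeffs (R : realType) (l : nat) (m : 'I_l.+1 -> rat) (t : R) : R :=
  \sum_(r < l.+1) ratr (m r) * hpoly t ^+ r.

(* The derivative at an endpoint of [a, b] is the two-sided one. *)
Definition U_shaped (R : realType) (f : R -> R) (a b t0 : R) : Prop :=
  [/\ a <= t0 <= b,
      forall t, a <= t <= b -> derivable f t 1,
      forall t, a < t < t0 -> derive1 f t < 0,
      derive1 f t0 = 0 &
      forall t, t0 < t <= b -> 0 < derive1 f t].

(* Main.v *)
Require Import Defs.
From mathcomp Require Import all_boot all_order all_algebra archimedean.
From mathcomp Require Import all_classical all_reals all_analysis.
From mathcomp Require Import measurable_realfun ring lra zify.
Import Order.TTheory GRing.Theory Num.Theory.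
Import numFieldNormedType.Exports.
Local Open Scope classical_set_scope.
Local Open Scope ring_scope.
Set Implicit Arguments.
Unset Strict Implicit.
Unset Printing Implicit Defensive.

(** The theta ratio of [L] is [f_L (t tau)] with [t tau] in the unit interval, so the
    theorem is about the extreme values of [f_L] on that interval.  A U-shaped
    function is minimal at its turning point and is bounded above by its values
    at the two ends; here [h 0 = h 1 = 1] and [h (1 / sqrt 2) = 3 / 4], which
    gives [1] as the upper bound (the coefficients sum to [1]) and the sum of
    the [m_r (3/4)^r] as the lower one.  Multiplying by the theta series of the
    cubic lattice, which is [theta3 ^ n] because the Gaussian is a product over
    the coordinates ([esum_rV_prod], [Zlattice_theta]), gives the two-sided
    bound.

    The minimum is attained at [tau = 1] because [t 1 = 1 / sqrt 2]
    ([tparam1]).  This is where the modular behaviour of theta functions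
    enters, and it is obtained from arithmetic-geometric means, without
    Poisson summation.  Write [theta2] for the sum of the Gaussian over the
    half-odd integers.  Splitting the integers by parity ([theta3_split],
    [theta4E]) and rotating the square lattice by 45 degrees ([theta3_sqr])
    yield the duplication formulas, which say two things:
    - the squares of [theta3] and [theta4] at [1, 2, 4, ...] form an
      arithmetic-geometric mean sequence ([agm_theta_up]);
    - the squares of [theta3] and [theta2] at [1, 1/2, 1/4, ...], multiplied by
      these numbers, form another one ([agm_theta_down]).
    Both start with the same first term [theta3 1 ^ 2].  Comparing the theta
    sum with the integral of the Gaussian gives
    [1 / sqrt t - 1 <= theta3 t <= 1 + 1 / sqrt t] ([theta3_bounds]), whence
    both sequences converge to [1].  The arithmetic-geometric mean is strictly
    increasing in its second argument ([agm_limit_inj]), so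
    [theta2 1 ^ 2 = theta4 1 ^ 2], and the identity
    [theta3 ^ 4 = theta2 ^ 4 + theta4 ^ 4] becomes [theta3 1 ^ 4 = 2 theta4 1 ^ 4]. *)

(** * Unordered sums of nonnegative families *)

Lemma esumZl (R : realType) (I : choiceType) (D : set I) (c : R)
    (a : I -> \bar R) :
  0 <= c -> (forall i, (0 <= a i)%E) ->
  (\esum_(i in D) (c%:E * a i) = c%:E * \esum_(i in D) a i)%E.
Proof.
move=> c0 a0; rewrite /esum -ereal_supZl//; last first.
  by apply/set0P; exists (\sum_(x \in set0) a x)%E, set0 => //; exact: fsets_set0.
congr ereal_sup; apply/seteqP; split => [_ [X [finX XD] <-]|_ [_ [X [finX XD] <-] <-]].
  exists (\sum_(x \in X) a x)%E; first by exists X.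
  by rewrite ge0_mule_fsumr.
by exists X => //; rewrite ge0_mule_fsumr.
Qed.

Lemma reindex_esumT (R : realType) (I J : choiceType) (e : I -> J)
    (a : J -> \bar R) :
  bijective e -> \esum_(j in [set: J]) a j = \esum_(i in [set: I]) a (e i).
Proof.
by rewrite -setTT_bijective; exact: reindex_esum.
Qed.

Lemma exchange_esum (R : realType) (I J : choiceType) (a : I -> J -> \bar R) :
  (forall i j, 0 <= a i j)%E ->
  \esum_(i in [set: I]) \esum_(j in [set: J]) a i j =
  \esum_(j in [set: J]) \esum_(i in [set: I]) a i j.
Proof.
move=> a0; rewrite !esum_esum//.
have -> : [set: I] `*`` (fun=> [set: J]) = setT by exact/seteqP.
have -> : [set: J] `*`` (fun=> [set: I]) = setT by exact/seteqP.
rewrite (@reindex_esumT _ _ _ (fun x : J * I => (x.2, x.1)))//.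
by exists (fun x : I * J => (x.2, x.1)) => -[].
Qed.

Lemma esum_parity (R : realType) (a : int -> \bar R) :
  (forall v, 0 <= a v)%E ->
  (\esum_(v in [set: int]) a v =
   \esum_(v in [set: int]) a (2 * v)%R + \esum_(v in [set: int]) a (2 * v + 1)%R)%E.
Proof.
move=> a0; pose B := [set (2 * v)%R | v in [set: int]].
rewrite (@esumID _ _ B)// !setTI; congr (_ + _)%E.
  by rewrite esum_image// => x y _ _ ?; lia.
have -> : ~` B = [set (2 * v + 1)%R | v in [set: int]].
  apply/seteqP; split => [x /= Bx|x [v _ <-] [w _]]; last by lia.
  exists (x %/ 2)%Z => //; have := divz_eq x 2.
  have x2 : (x %% 2)%Z != 0.
    by apply/eqP => x2; apply: Bx; exists (x %/ 2)%Z => //; have := divz_eq x 2; lia.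
  by have := modz_ge0 x (isT : (2 : int) != 0); have := ltz_pmod x (isT : 0 < (2 : int)); lia.
by rewrite esum_image// => x y _ _ ?; lia.
Qed.

Lemma esum_sign (R : realType) (a : int -> \bar R) :
  (forall v, 0 <= a v)%E ->
  (\esum_(v in [set: int]) a v =
   \esum_(k in [set: nat]) a k + \esum_(k in [set: nat]) a (Negz k))%E.
Proof.
move=> a0; pose B := [set Posz v | v in [set: nat]].
rewrite (@esumID _ _ B)// !setTI; congr (_ + _)%E.
  by rewrite esum_image// => x y _ _ [].
have -> : ~` B = [set Negz v | v in [set: nat]].
  apply/seteqP; split => [[k|k] /= Bx|x [v _ <-] [w _]] //.
  - by case: Bx; exists k.
  - by exists k.
by rewrite esum_image// => x y _ _ [].
Qed.

Lemma esum_natS (R : realType) (a : nat -> \bar R) :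
  (forall k, 0 <= a k)%E ->
  (\esum_(k in [set: nat]) a k = a 0%N + \esum_(k in [set: nat]) a k.+1)%E.
Proof.
move=> a0; rewrite (@esumID _ _ [set 0%N])// !setTI esum_set1//; congr (_ + _)%E.
have -> : ~` [set 0%N] = [set k.+1 | k in [set: nat]].
  by apply/seteqP; split => [[|k] //= _|_ [k _ <-]] //; exists k.
by rewrite esum_image// => x y _ _ [].
Qed.

(** A sum over all integer vectors of a product over coordinates factors; by
    induction on the dimension, splitting off the first coordinate. *)
Lemma esum_rV_prod (R : realType) (a : int -> R) (S : R) (n : nat) :
  (forall v, 0 <= a v) ->
  (\esum_(v in [set: int]) (a v)%:E = S%:E)%E ->
  \esum_(z in [set: 'rV[int]_n]) (\prod_(i < n) a (z 0 i))%:E = (S ^+ n)%:E.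
Proof.
move=> a0 aS; elim: n => [|n IH].
  have -> : [set: 'rV[int]_0] = [set 0].
    by apply/seteqP; split => // z _ /=; apply/matrixP => i [].
  by rewrite esum_set1 big_ord0 // lee_fin.
pose e (x : int * 'rV[int]_n) : 'rV[int]_n.+1 :=
  (row_mx (x.1%:M : 'M[int]_1) x.2 : 'rV[int]_(1 + n)).
(* The inverse of [e] separates the first coordinate from the others. *)
rewrite (@reindex_esumT _ _ _ e); last first.
  exists (fun z : 'rV[int]_(1 + n) => (lsubmx z 0 0, rsubmx z)) => [[v w]|z].
    by rewrite /e /= row_mxKl row_mxKr mxE eqxx mulr1n.
  by rewrite /e /= -mx11_scalar hsubmxK.
under eq_esum => x _.
  rewrite big_ord_recl /=.
  have -> : e x 0 ord0 = x.1.
    transitivity (row_mx (x.1%:M : 'M[int]_1) x.2 0 (lshift n 0)).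
      by congr (row_mx _ _ _ _); exact: val_inj.
    by rewrite row_mxEl mxE eqxx mulr1n.
  have -> : \prod_(i < n) a (e x 0 (lift ord0 i)) = \prod_(i < n) a (x.2 0 i).
    apply: eq_bigr => i _.
    congr (a _); transitivity (row_mx (x.1%:M : 'M[int]_1) x.2 0 (rshift 1 i)).
      by congr (row_mx _ _ _ _); exact: val_inj.
    by rewrite row_mxEr.
  over.
have -> : [set: int * 'rV[int]_n] = [set: int] `*`` (fun=> [set: 'rV[int]_n]).
  exact/seteqP.
have p0 (z : 'rV[int]_n) : 0 <= \prod_(i < n) a (z 0 i) by exact: prodr_ge0.
rewrite -(@esum_esum _ _ _ setT (fun=> setT)
  (fun (v : int) (z : 'rV[int]_n) => (a v * \prod_(i < n) a (z 0 i))%:E)); last first.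
  by move=> v z _ _; rewrite lee_fin mulr_ge0.
under eq_esum => v _.
  under eq_esum => z _ do rewrite EFinM.
  rewrite esumZl//.
  rewrite IH muleC; over.
have S0 : 0 <= S by rewrite -lee_fin -aS esum_ge0// => v _; rewrite lee_fin.
rewrite esumZl ?exprn_ge0//.
by rewrite aS -EFinM exprSr.
Qed.

(** * Gaussian sums and the Gaussian integral *)

Definition gaussian (R : realType) (t x : R) : R := expR (- pi * t * x ^+ 2).

Lemma gaussian_ge0 (R : realType) (t x : R) : 0 <= gaussian t x.
Proof. exact: expR_ge0. Qed.

Lemma gaussianE (R : realType) (t x : R) :
  0 <= t -> gaussian t x = gauss_fun (Num.sqrt (pi * t) * x).
Proof.
move=> t0; rewrite /gaussian /gauss_fun exprMn sqr_sqrtr ?mulr_ge0 ?pi_ge0//.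
by rewrite !mulNr.
Qed.

Lemma gauss_fun_nincr (R : realType) (x y : R) :
  0 <= x -> x <= y -> gauss_fun y <= gauss_fun x.
Proof.
move=> x0 xy; rewrite /gauss_fun ler_expR lerN2 ler_sqr ?nnegrE//.
exact: le_trans xy.
Qed.

(** The half line is cut into cells of width [d], on each of which the monotone
    integrand is compared with its values at the two ends
    ([integral_gauss_cell]). *)
Lemma gauss_integral_grid (R : realType) (d : R) : 0 < d ->
  (\sum_(0 <= k <oo)
     \int[@lebesgue_measure R]_(x in `[(d * k%:R)%R, (d * k.+1%:R)%R[)
       (gauss_fun x)%:E)%E = (Num.sqrt pi / 2)%:E.
Proof.
move=> d0; rewrite -integral0y_gauss.
have -> : ([set` `[0%R, +oo[] : set R) =
    \bigcup_k [set` `[(d * k%:R)%R, (d * k.+1%:R)%R[ ].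
  apply/seteqP; split => x /=; rewrite !in_itv /= ?andbT.
    move=> x0; exists (Num.truncn (x / d)) => //=; rewrite in_itv /=.
    have /(@truncn_itv R) /andP[] : 0 <= x / d by rewrite divr_ge0// ltW.
    by rewrite ler_pdivlMr// ltr_pdivrMr// ![_ * d]mulrC => -> ->.
  case=> k _ /=; rewrite in_itv /= => /andP[+ _]; apply: le_trans.
  by rewrite mulr_ge0// ltW.
rewrite ge0_integral_bigcup//.
- by apply/measurable_EFinP/measurable_funTS; exact: measurable_gauss_fun.
- by move=> x _; rewrite lee_fin gauss_fun_ge0.
- apply: ltn_trivIset => i j ij; rewrite -subset0 => x [] /=.
  rewrite !in_itv /= => /andP[_ h1] /andP[h2 _].
  have := le_lt_trans h2 h1; rewrite ltr_pM2l// ltr_nat => ji.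
  by have := leq_trans ij ji; rewrite ltnn.
Qed.

Lemma integral_gauss_cell (R : realType) (a b : R) : 0 <= a -> a < b ->
  (((b - a) * gauss_fun b)%:E
     <= \int[@lebesgue_measure R]_(x in `[a, b[) (gauss_fun x)%:E
     <= ((b - a) * gauss_fun a)%:E)%E.
Proof.
move=> a0 ab.
have cst_int (c : R) :
    (\int[@lebesgue_measure R]_(x in `[a, b[) c%:E = ((b - a) * c)%:E)%E.
  by rewrite integral_cst//= lebesgue_measure_itv /= lte_fin ab -EFinD -EFinM mulrC.
have mg : measurable_fun `[a, b[ (EFin \o @gauss_fun R).
  by apply/measurable_EFinP/measurable_funTS; exact: measurable_gauss_fun.
rewrite -!cst_int; apply/andP; split; apply: ge0_le_integral => //=.
all: move=> x; rewrite in_itv /= ?lee_fin ?gauss_fun_ge0// => /andP[ax xb].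
- by rewrite gauss_fun_nincr ?(le_trans a0)// ltW.
- by rewrite gauss_fun_nincr.
Qed.

(** The integral test for [exp (- pi t x ^ 2)], whose integral over the half
    line is [1 / (2 sqrt t)]; the first term of the sum, at [0], is [1].  The
    substitution is avoided by taking [sqrt (pi t)] as the mesh for the
    standard Gaussian [exp (- x ^ 2)]. *)
Lemma gaussian_sum_bounds (R : realType) (t : R) : 0 < t ->
  (\esum_(k in [set: nat]) (gaussian t k.+1%:R)%:E
     <= ((2 * Num.sqrt t)^-1)%:E
     <= 1 + \esum_(k in [set: nat]) (gaussian t k.+1%:R)%:E)%E.
Proof.
move=> t0; have p0 : 0 < pi :> R := pi_gt0 R.
pose d := Num.sqrt (pi * t); have d0 : 0 < d by rewrite sqrtr_gt0 mulr_gt0.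
have g0 (x : R) : (0 <= (gaussian t x)%:E)%E by rewrite lee_fin gaussian_ge0.
have cell (k : nat) : 0 <= d * k%:R /\ d * k%:R < d * k.+1%:R.
  by rewrite ltr_pM2l// ltr_nat mulr_ge0// ltW.
have cellE (k : nat) : d * k.+1%:R - d * k%:R = d.
  by rewrite -mulrBr -natrB// subSn// subnn mulr1.
have gE (x : R) : gauss_fun (d * x) = gaussian t x by rewrite gaussianE// ltW.
have dS : d * (2 * Num.sqrt t)^-1 = Num.sqrt pi / 2.
  rewrite /d sqrtrM ?ltW// invfM mulrACA -mulrA; congr (_ * _).
  by rewrite mulfV ?mulr1// gt_eqF// sqrtr_gt0.
have sumE (s : nat -> R) : (forall k, 0 <= s k) ->
    (\sum_(0 <= k <oo) (d * s k)%:E = d%:E * \esum_(k in [set: nat]) (s k)%:E)%E.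
  move=> s0; rewrite nneseries_esumT; last first.
    by move=> k; rewrite lee_fin mulr_ge0// ltW.
  by under eq_esum => k _ do rewrite EFinM; rewrite esumZl// ltW.
have -> : (1 + \esum_(k in [set: nat]) (gaussian t k.+1%:R)%:E =
           \esum_(k in [set: nat]) (gaussian t k%:R)%:E)%E.
  rewrite [RHS]esum_natS//.
  by congr (_ + _)%E; rewrite /gaussian expr0n /= mulr0 expR0.
(* Both inequalities are proved after multiplication by the mesh. *)
have mono (u v : \bar R) : (d%:E * u <= d%:E * v -> u <= v)%E.
  by rewrite lee_pmul2l// lte_fin.
apply/andP; split; apply: mono; rewrite -EFinM dS -(gauss_integral_grid d0).
  rewrite -sumE; last by move=> k; exact: gaussian_ge0.
  apply: lee_nneseries => k _; first by rewrite lee_fin mulr_ge0 ?gaussian_ge0// ltW.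
  have [c1 c2] := cell k.
  by have /andP[+ _] := integral_gauss_cell c1 c2; rewrite cellE gE.
rewrite -sumE; last by move=> k; exact: gaussian_ge0.
apply: lee_nneseries => k _.
  by move=> _; apply: integral_ge0 => x _; rewrite lee_fin gauss_fun_ge0.
have [c1 c2] := cell k.
by have /andP[_] := integral_gauss_cell c1 c2; rewrite cellE gE.
Qed.

(** * Theta functions as real numbers *)

Definition theta2 (R : realType) (t : R) : R :=
  fine (\esum_(v in [set: int]) (gaussian t (v%:~R + 1 / 2))%:E).

Lemma real_sum_ge0 (R : realType) (I : choiceType) (D : set I) (f : I -> R) :
  (forall i, 0 <= f i) -> real_sum D f = fine (\esum_(i in D) (f i)%:E).
Proof.
move=> f0; rewrite /real_sum [X in _ - fine X]esum1 ?subr0.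
  by congr fine; apply: eq_esum => i _; rewrite max_l.
by move=> i _; rewrite max_r ?oppr_le0 ?gaussian_ge0.
Qed.

Lemma gaussian_EFin_ge0 (R : realType) (t x : R) : (0 <= (gaussian t x)%:E)%E.
Proof. by rewrite lee_fin gaussian_ge0. Qed.
Local Hint Resolve gaussian_ge0 gaussian_EFin_ge0 : core.

Lemma theta3_fine (R : realType) (t : R) :
  theta3 t = fine (\esum_(v in [set: int]) (gaussian t v%:~R)%:E).
Proof. by rewrite /theta3 real_sum_ge0// => v; exact: expR_ge0. Qed.

(** The sum over the integers is [1] plus twice the sum over the positive
    integers, so the integral test also shows that it is finite. *)
Lemma theta3_bounds (R : realType) (t : R) : 0 < t ->
  [/\ (\esum_(v in [set: int]) (gaussian t v%:~R)%:E)%E = (theta3 t)%:E,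
      1 <= theta3 t, theta3 t <= 1 + (Num.sqrt t)^-1 &
      (Num.sqrt t)^-1 - 1 <= theta3 t].
Proof.
move=> t0; have /andP[] := gaussian_sum_bounds t0.
have eX : (\esum_(v in [set: int]) (gaussian t v%:~R)%:E =
    1 + 2%:E * \esum_(k in [set: nat]) (gaussian t k.+1%:R)%:E)%E.
  rewrite esum_sign// esum_natS// -addeA; congr (_ + _)%E.
    by rewrite /gaussian expr0n /= mulr0 expR0.
  rewrite -[2]/(1 + 1) EFinD ge0_muleDl// !mul1e; congr (_ + _)%E.
  by apply: eq_esum => k _; rewrite NegzE /gaussian mulrNz sqrrN.
have := esum_ge0 (fun k (_ : [set: nat] k) => gaussian_EFin_ge0 t k.+1%:R).
rewrite theta3_fine eX.
case: (esum _ _) => [s| |] //.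
rewrite -!EFinM -!EFinD /= !lee_fin invfM => s0 h1 h2.
by split => //; lra.
Qed.

Lemma theta3E (R : realType) (t : R) : 0 < t ->
  (\esum_(v in [set: int]) (gaussian t v%:~R)%:E)%E = (theta3 t)%:E.
Proof. by case/theta3_bounds. Qed.

Lemma theta3_gt0 (R : realType) (t : R) : 0 < t -> 0 < theta3 t.
Proof. by case/theta3_bounds => _ t1 _ _; exact: lt_le_trans t1. Qed.

Lemma gaussian_even (R : realType) (t : R) (v : int) :
  gaussian t (2 * v)%:~R = gaussian (4 * t) v%:~R.
Proof. by rewrite /gaussian intrM; congr expR; ring. Qed.

Lemma gaussian_odd (R : realType) (t : R) (v : int) :
  gaussian t (2 * v + 1)%:~R = gaussian (4 * t) (v%:~R + 1 / 2).
Proof. by rewrite /gaussian intrD intrM; congr expR; field. Qed.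

(** The even integers contribute [theta3 (4 t)] and the odd ones
    [theta2 (4 t)].  The first part is the finiteness that makes the
    real number [theta2] faithful to its defining sum. *)
Lemma theta3_split (R : realType) (t : R) : 0 < t ->
  (\esum_(v in [set: int]) (gaussian (4 * t) (v%:~R + 1 / 2))%:E)%E
    = (theta2 (4 * t))%:E /\
  theta3 t = theta3 (4 * t) + theta2 (4 * t).
Proof.
move=> t0; have t40 : 0 < 4 * t by rewrite mulr_gt0.
have := theta3E t0; rewrite esum_parity//.
under eq_esum => v _ do rewrite gaussian_even.
under [X in (_ + X)%E]eq_esum => v _ do rewrite gaussian_odd.
rewrite theta3E// /theta2.
have := esum_ge0 (fun k (_ : [set: int] k) => gaussian_EFin_ge0 (4 * t) (k%:~R + 1 / 2)).
by case: (esum _ _) => //= s _ [<-].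
Qed.

Lemma theta2E (R : realType) (t : R) : 0 < t ->
  (\esum_(v in [set: int]) (gaussian t (v%:~R + 1 / 2))%:E)%E = (theta2 t)%:E.
Proof.
move=> t0; have t40 : 0 < t / 4 by rewrite divr_gt0.
by have [+ _] := theta3_split t40; rewrite mulrC divfK.
Qed.

Lemma theta2_gt0 (R : realType) (t : R) : 0 < t -> 0 < theta2 t.
Proof.
move=> t0; have : (0 < \esum_(v in [set: int]) (gaussian t (v%:~R + 1 / 2))%:E)%E.
  apply: (@lt_le_trans _ _ (gaussian t (0%:~R + 1 / 2))%:E).
    by rewrite lte_fin expR_gt0.
  apply: esum_ge; exists [set 0]; first by split; [exact: finite_set1|].
  by rewrite fsbig_set1.
by rewrite theta2E// lte_fin.
Qed.

(** In [theta4] the positive part of the family lives on the even integers and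
    the negative part on the odd ones. *)
Lemma theta4E (R : realType) (t : R) : 0 < t ->
  theta4 t = theta3 (4 * t) - theta2 (4 * t).
Proof.
move=> t0; have t40 : 0 < 4 * t by rewrite mulr_gt0.
have even v : (-1) ^ (2 * v) = 1 :> R by rewrite -exprz_exp -exprnP sqrrN expr1n exp1rz.
have odd v : (-1) ^ (2 * v + 1) = -1 :> R.
  by rewrite expfzDr ?even ?mul1r ?oppr_eq0 ?oner_eq0.
have max0 (x : R) : (0 <= (Num.max x 0)%:E)%E by rewrite lee_fin le_max lexx orbT.
rewrite /theta4 /real_sum [X in fine X - _]esum_parity//.
rewrite [X in _ - fine X]esum_parity//.
rewrite [X in (X + _)%E](_ : _ = (theta3 (4 * t))%:E); last first.
  rewrite -theta3E//; apply: eq_esum => v _.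
  by rewrite even mul1r -/(gaussian t _) gaussian_even max_l ?gaussian_ge0.
rewrite [X in (_ + X)%E](_ : _ = 0%E); last first.
  apply: esum1 => v _.
  by rewrite odd mulN1r -/(gaussian t _) max_r ?oppr_le0 ?gaussian_ge0.
rewrite [X in _ - fine (X + _)%E](_ : _ = 0%E); last first.
  apply: esum1 => v _.
  by rewrite even mul1r -/(gaussian t _) max_r ?oppr_le0 ?gaussian_ge0.
rewrite [X in _ - fine (_ + X)%E](_ : _ = (theta2 (4 * t))%:E); last first.
  rewrite -theta2E//; apply: eq_esum => v _.
  by rewrite odd mulN1r opprK -/(gaussian t _) gaussian_odd max_l ?gaussian_ge0.
by rewrite adde0 add0e.
Qed.

(** * The duplication formulas *)

Lemma esum_mul (R : realType) (I J : choiceType) (a : I -> R) (b : J -> R) (A B : R) :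
  (forall i, 0 <= a i) -> (forall j, 0 <= b j) ->
  (\esum_(i in [set: I]) (a i)%:E = A%:E)%E ->
  (\esum_(j in [set: J]) (b j)%:E = B%:E)%E ->
  \esum_(i in [set: I]) \esum_(j in [set: J]) (a i * b j)%:E = (A * B)%:E.
Proof.
move=> a0 b0 aA bB.
under eq_esum => i _.
  under eq_esum => j _ do rewrite EFinM.
  rewrite esumZl//.
  rewrite bB muleC; over.
have B0 : 0 <= B by rewrite -lee_fin -bB esum_ge0// => v _; rewrite lee_fin.
by rewrite esumZl// aA -EFinM mulrC.
Qed.

(** Since [(x - y) ^ 2 + (x + y) ^ 2 = 2 (x ^ 2 + y ^ 2)]. *)
Lemma gaussian_rotate (R : realType) (t x y : R) :
  gaussian t (x - y) * gaussian t (x + y) = gaussian (2 * t) x * gaussian (2 * t) y.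
Proof. by rewrite /gaussian -!expRD; congr expR; ring. Qed.

(** The pairs of integers of equal parity are the [(p - b, p + b)] and those of
    opposite parity the [(p - b, p + b + 1)]: for a fixed first coordinate [u],
    the second is written [u + w] with [w] even or odd. *)
Lemma esum_rotate (R : realType) (F : int -> int -> \bar R) :
  (forall u v, 0 <= F u v)%E ->
  (\esum_(u in [set: int]) \esum_(v in [set: int]) F u v =
   \esum_(p in [set: int]) \esum_(b in [set: int]) F (p - b)%R (p + b)%R +
   \esum_(p in [set: int]) \esum_(b in [set: int]) F (p - b)%R (p + b + 1)%R)%E.
Proof.
move=> F0.
have step u : (\esum_(v in [set: int]) F u v =
    \esum_(b in [set: int]) F u (u + 2 * b)%R +
    \esum_(b in [set: int]) F u (u + (2 * b + 1))%R)%E.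
  rewrite -(esum_parity (a := fun w => F u (u + w)))//; apply: reindex_esumT.
  by exists (fun w => w - u) => w; ring.
have shift (b : int) : bijective (fun p => p - b).
  by exists (fun p => p + b) => p; ring.
under eq_esum => u _ do rewrite step.
rewrite esumD; try by move=> *; exact: esum_ge0.
congr (_ + _)%E; rewrite exchange_esum; try by move=> *; exact: F0.
all: rewrite [RHS]exchange_esum; try by move=> *; exact: F0.
all: apply: eq_esum => b _; rewrite (reindex_esumT _ (shift b)).
all: by apply: eq_esum => p _; congr F; ring.
Qed.

(** The square is a sum over the square lattice, rotated as in [esum_rotate].
    Pairs of opposite parity give [theta2] because [p - b] and [p + b + 1] are
    the difference and the sum of [p + 1 / 2] and [b + 1 / 2]. *)
Lemma theta3_sqr (R : realType) (t : R) : 0 < t ->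
  theta3 t ^+ 2 = theta3 (2 * t) ^+ 2 + theta2 (2 * t) ^+ 2.
Proof.
move=> t0; have t20 : 0 < 2 * t by rewrite mulr_gt0.
apply: EFin_inj; rewrite EFinD !expr2.
rewrite -(esum_mul _ _ (theta3E t0) (theta3E t0))//.
rewrite -(esum_mul _ _ (theta3E t20) (theta3E t20))//.
rewrite -(esum_mul _ _ (theta2E t20) (theta2E t20))//.
rewrite (@esum_rotate _ (fun u v : int => (gaussian t u%:~R * gaussian t v%:~R)%:E));
  last by move=> u v; rewrite lee_fin mulr_ge0 ?gaussian_ge0.
congr (_ + _)%E; apply: eq_esum => p _; apply: eq_esum => b _; congr EFin;
  rewrite -gaussian_rotate; congr (gaussian _ _ * gaussian _ _).
- by rewrite !intrD !mulrNz.
- by rewrite !intrD.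
- by rewrite !intrD !mulrNz; ring.
- by rewrite !intrD; field.
Qed.

(** Obtained by expanding [theta3 (t / 2) ^ 2] in two ways, by the rotation and
    by [theta3 (t / 2) = theta3 (2 t) + theta2 (2 t)]. *)
Lemma theta2_sqr (R : realType) (t : R) : 0 < t ->
  theta2 t ^+ 2 = 2 * theta3 (2 * t) * theta2 (2 * t).
Proof.
move=> t0; have s0 : 0 < t / 2 by rewrite divr_gt0.
have := theta3_sqr s0; have [_ ->] := theta3_split s0.
have -> : 4 * (t / 2) = 2 * t by field.
have -> : 2 * (t / 2) = t by field.
by rewrite (theta3_sqr t0) => e; lra.
Qed.

Lemma theta4_sqr (R : realType) (t : R) : 0 < t ->
  theta4 t ^+ 2 = theta3 (2 * t) ^+ 2 - theta2 (2 * t) ^+ 2.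
Proof.
move=> t0; have t20 : 0 < 2 * t by rewrite mulr_gt0.
rewrite theta4E// (theta2_sqr t20) (theta3_sqr t20).
have -> : 2 * (2 * t) = 4 * t by ring.
by ring.
Qed.

Lemma theta3_theta4_mean (R : realType) (t : R) : 0 < t ->
  theta3 (2 * t) ^+ 2 = (theta3 t ^+ 2 + theta4 t ^+ 2) / 2.
Proof. by move=> t0; rewrite (theta3_sqr t0) (theta4_sqr t0); field. Qed.

Lemma theta4_double_sqr (R : realType) (t : R) : 0 < t ->
  theta4 (2 * t) ^+ 2 = theta3 t * theta4 t.
Proof.
move=> t0; have t20 : 0 < 2 * t by rewrite mulr_gt0.
rewrite (theta4_sqr t20) (theta3_split t0).2 theta4E//.
have -> : 2 * (2 * t) = 4 * t by ring.
by ring.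
Qed.

Lemma jacobi_identity (R : realType) (t : R) : 0 < t ->
  theta3 t ^+ 4 = theta2 t ^+ 4 + theta4 t ^+ 4.
Proof.
move=> t0; rewrite !(exprM _ 2 2) (theta2_sqr t0) (theta3_sqr t0) (theta4_sqr t0).
by ring.
Qed.

(** * Arithmetic-geometric means *)

(** The geometric mean is given through its square, which determines it among
    nonnegative numbers. *)
Definition agm_sequence (R : realType) (a b : nat -> R) : Prop :=
  [/\ forall n, 0 < a n, forall n, 0 <= b n,
      forall n, a n.+1 = (a n + b n) / 2 &
      forall n, b n.+1 ^+ 2 = a n * b n].

(** An explicit factor exceeding [1] that still works when [x = 0]. *)
Lemma scaling_gap (R : realType) (x y : R) : 0 <= x -> x < y ->
  1 < 2 * y / (x + y) /\ 2 * y / (x + y) * x <= y.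
Proof.
move=> x0 xy; have xy0 : 0 < x + y by lra.
split; first by rewrite ltr_pdivlMr//; lra.
rewrite mulrAC ler_pdivrMr// -subr_ge0.
have -> : y * (x + y) - 2 * y * x = y * (y - x) by ring.
by rewrite mulr_ge0; lra.
Qed.

(** The mean is homogeneous and monotone.  A strict inequality between the
    second starting values makes both terms of the next step strictly larger,
    hence larger by a factor [r > 1], and this factor then persists. *)
Lemma agm_scaling (R : realType) (a b a' b' : nat -> R) :
  agm_sequence a b -> agm_sequence a' b' -> a 0%N = a' 0%N -> b 0%N < b' 0%N ->
  exists2 r : R, 1 < r & forall n, r * a n.+1 <= a' n.+1.
Proof.
move=> [a0 b0 aS bS] [a'0 b'0 a'S b'S] e0 lb.
have la1 : a 1%N < a' 1%N by rewrite aS a'S e0; lra.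
have lb1 : b 1%N < b' 1%N.
  rewrite -ltr_sqr ?nnegrE// bS b'S e0 ltr_pM2l//.
have [r1 rA] := scaling_gap (ltW (a0 1%N)) la1.
have [s1 sB] := scaling_gap (b0 1%N) lb1.
set r := 2 * a' 1%N / _ in r1 rA; set s := 2 * b' 1%N / _ in s1 sB.
exists (Num.min r s); first by rewrite lt_min r1.
set m := Num.min r s.
have m0 : 0 <= m by rewrite le_min !ltW// (lt_trans ltr01).
suff main n : m * a n.+1 <= a' n.+1 /\ m * b n.+1 <= b' n.+1.
  by move=> n; case: (main n).
elim: n => [|n [IHa IHb]].
  split; [apply: le_trans rA|apply: le_trans sB]; rewrite ler_wpM2r//.
  - exact: ltW.
  - by rewrite ge_min lexx.
  - by rewrite ge_min lexx orbT.
split; first by rewrite aS a'S; lra.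
rewrite -ler_sqr ?nnegrE ?mulr_ge0// exprMn bS b'S expr2 mulrACA.
by rewrite ler_pM ?mulr_ge0// ltW.
Qed.

Lemma agm_limit_inj (R : realType) (a b a' b' : nat -> R) (l : R) :
  agm_sequence a b -> agm_sequence a' b' -> a 0%N = a' 0%N -> 0 < l ->
  a @ \oo --> l -> a' @ \oo --> l -> b 0%N = b' 0%N.
Proof.
move=> ab ab' e0 l0 al al'.
wlog lt_b : a b a' b' ab ab' e0 al al' / b 0%N < b' 0%N.
  move=> H; case: (ltgtP (b 0%N) (b' 0%N)) => // hb.
  - exact: (H a b a' b').
  - by apply/esym; exact: (H a' b' a b).
have [r r1 rle] := agm_scaling ab ab' e0 lt_b.
have ral : (fun n => r * a n.+1) @ \oo --> r * l.
  by apply: cvgMr; rewrite (cvg_shiftS a).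
have a'l : (fun n => a' n.+1) @ \oo --> l by rewrite (cvg_shiftS a').
have : r * l <= l by apply: (ler_cvg_to ral a'l); exact: nearW.
by rewrite ger_pMl// leNgt r1.
Qed.

(** * The self-dual point *)

Lemma cvg_pow_sqrt2_inv (R : realType) :
  (fun n => (Num.sqrt 2 : R)^-1 ^+ n) @ \oo --> (0 : R).
Proof.
apply: cvg_expr; rewrite ger0_norm ?invr_ge0 ?sqrtr_ge0//.
by rewrite invf_lt1 ?sqrtr_gt0// -[X in X < _]sqrtr1 ltr_sqrt// ltr1n.
Qed.

Lemma sqrt_pow2 (R : realType) (n : nat) :
  Num.sqrt (2 ^+ n) = (Num.sqrt 2 : R) ^+ n.
Proof. by elim: n => [|n IH]; rewrite ?sqrtr1// !exprS sqrtrM// IH. Qed.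

Lemma agm_theta_up (R : realType) :
  agm_sequence (fun n => theta3 (2 ^+ n : R) ^+ 2) (fun n => theta4 (2 ^+ n : R) ^+ 2).
Proof.
have p0 n : 0 < 2 ^+ n :> R by rewrite exprn_gt0.
have pS n : 2 ^+ n.+1 = 2 * 2 ^+ n :> R by exact: exprS.
split => n.
- by rewrite exprn_gt0// theta3_gt0.
- exact: sqr_ge0.
- by rewrite pS (theta3_theta4_mean (p0 n)).
- by rewrite pS (theta4_double_sqr (p0 n)) exprMn.
Qed.

(** The factor [2^-n] absorbs the constants of the duplication formulas and
    balances the growth of [theta3] near [0]. *)
Lemma agm_theta_down (R : realType) :
  agm_sequence (fun n => 2^-1 ^+ n * theta3 (2^-1 ^+ n : R) ^+ 2)
               (fun n => 2^-1 ^+ n * theta2 (2^-1 ^+ n : R) ^+ 2).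
Proof.
have p0 n : 0 < 2^-1 ^+ n :> R by rewrite exprn_gt0// invr_gt0.
have dbl n : 2 * 2^-1 ^+ n.+1 = 2^-1 ^+ n :> R by rewrite exprS mulVKf.
have pS n : 2^-1 ^+ n.+1 = 2^-1 ^+ n / 2 :> R by exact: exprSr.
split => n.
- by rewrite mulr_gt0// exprn_gt0// theta3_gt0.
- by rewrite mulr_ge0 ?sqr_ge0// ltW.
- by rewrite (theta3_sqr (p0 n.+1)) dbl pS; field.
- by rewrite (theta2_sqr (p0 n.+1)) dbl pS; field.
Qed.

Lemma cvg_theta_up (R : realType) :
  (fun n => theta3 (2 ^+ n : R) ^+ 2) @ \oo --> (1 : R).
Proof.
rewrite -[X in _ --> X](expr1n R 2).
apply: (cvg_comp (fun n => theta3 (2 ^+ n : R)) (fun x : R => x ^+ 2)); last first.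
  exact: exprn_continuous.
apply: (@squeeze_cvgr _ _ _ _ (cst 1) (fun n => 1 + (Num.sqrt 2 : R)^-1 ^+ n)).
- apply: nearW => n; have p0 : 0 < 2 ^+ n :> R by rewrite exprn_gt0.
  by have [_ -> h _] := theta3_bounds p0; rewrite exprVn -sqrt_pow2.
- exact: cvg_cst.
- rewrite -[X in _ --> X]addr0; apply: cvgD; first exact: cvg_cst.
  exact: cvg_pow_sqrt2_inv.
Qed.

Lemma cvg_theta_down (R : realType) :
  (fun n => 2^-1 ^+ n * theta3 (2^-1 ^+ n : R) ^+ 2) @ \oo --> (1 : R).
Proof.
(* The square root of the sequence is squeezed between [1 - d n] and [1 + d n]. *)
pose d n := (Num.sqrt 2 : R)^-1 ^+ n.
have d0 n : 0 < d n by rewrite exprn_gt0// invr_gt0 sqrtr_gt0.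
have dE n : Num.sqrt (2^-1 ^+ n : R) = d n.
  by rewrite exprVn sqrtrV ?exprn_ge0// sqrt_pow2 /d exprVn.
have d2 n : 2^-1 ^+ n = d n ^+ 2 by rewrite -dE sqr_sqrtr// exprn_ge0// invr_ge0.
have -> : (fun n => 2^-1 ^+ n * theta3 (2^-1 ^+ n : R) ^+ 2) =
          (fun n => (d n * theta3 (2^-1 ^+ n : R)) ^+ 2).
  by apply/funext => n; rewrite exprMn -d2.
rewrite -[X in _ --> X](expr1n R 2).
apply: (cvg_comp (fun n => d n * theta3 (2^-1 ^+ n : R)) (fun x : R => x ^+ 2)); last first.
  exact: exprn_continuous.
apply: (@squeeze_cvgr _ _ _ _ (fun n => 1 - d n) (fun n => 1 + d n)).
- apply: nearW => n; have p0 : 0 < 2^-1 ^+ n :> R by rewrite exprn_gt0// invr_gt0.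
  have [_ _ h1 h2] := theta3_bounds p0; rewrite dE in h1 h2.
  have dV : d n * (d n)^-1 = 1 by rewrite mulfV// gt_eqF.
  move: h1 h2; set x := theta3 _ => h1 h2; rewrite -dV.
  have e1 : d n * (d n)^-1 + d n = d n * (1 + (d n)^-1) by ring.
  have e2 : d n * (d n)^-1 - d n = d n * ((d n)^-1 - 1) by ring.
  by rewrite e1 e2 !(ler_pM2l (d0 n)) h1 h2.
- rewrite -[X in _ --> X]subr0; apply: cvgB; first exact: cvg_cst.
  exact: cvg_pow_sqrt2_inv.
- rewrite -[X in _ --> X]addr0; apply: cvgD; first exact: cvg_cst.
  exact: cvg_pow_sqrt2_inv.
Qed.

(** The case [tau = 1] of the transformation formula exchanging [theta2] and
    [theta4], up to sign. *)
Lemma theta2_theta4_self_dual (R : realType) : theta2 (1 : R) ^+ 2 = theta4 (1 : R) ^+ 2.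
Proof.
have := agm_limit_inj (agm_theta_up R) (agm_theta_down R) _ ltr01
  (cvg_theta_up (R := R)) (cvg_theta_down (R := R)).
by rewrite !expr0 !mul1r => ->.
Qed.

Lemma tparam1 (R : realType) : tparam (1 : R) = 1 / Num.sqrt 2.
Proof.
have X0 := theta3_gt0 (@ltr01 R); have s0 : 0 < Num.sqrt 2 :> R by rewrite sqrtr_gt0.
have tp0 : 0 <= tparam (1 : R) by rewrite /tparam divr_ge0 ?sqr_ge0.
have sp0 : 0 <= 1 / Num.sqrt 2 :> R by rewrite divr_ge0// ltW.
apply/eqP; rewrite -(eqrXn2 (n := 2) _ tp0 sp0)//.
rewrite /tparam !expr_div_n expr1n sqr_sqrtr// eqr_div ?expf_neq0 ?(gt_eqF X0)//.
have -> : (theta3 (1 : R) ^+ 2) ^+ 2 = (theta2 1 ^+ 2) ^+ 2 + (theta4 1 ^+ 2) ^+ 2.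
  by rewrite -!exprM jacobi_identity.
by rewrite theta2_theta4_self_dual; apply/eqP; ring.
Qed.

(** * The theta series of the cubic lattice *)

Lemma Zlattice_theta (R : realType) (n : nat) (t : R) : 0 < t ->
  lattice_theta (@Zlattice R n) t = theta3 t ^+ n.
Proof.
move=> t0; rewrite /lattice_theta real_sum_ge0; last by move=> x; exact: expR_ge0.
rewrite /Zlattice /lattice_of esum_image; last first.
  move=> x y _ _; rewrite !mulmx1 => /matrixP e; apply/matrixP => i j.
  by have := e i j; rewrite !mxE => /intr_inj.
rewrite -[RHS]/(fine (theta3 t ^+ n)%:E).
rewrite -(esum_rV_prod n (fun v : int => gaussian_ge0 t v%:~R) (theta3E t0)).
congr fine.
apply: eq_esum => z _; rewrite mulmx1 /normsq /dotp mulr_sumr expR_sum.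
by congr EFin; apply: eq_bigr => i _; rewrite !mxE /gaussian expr2.
Qed.

(** * Extreme values *)

Lemma theta4_le_theta3 (R : realType) (t : R) : 0 < t -> `|theta4 t| <= theta3 t.
Proof.
move=> t0; have t40 : 0 < 4 * t by rewrite mulr_gt0.
rewrite (theta4E t0) (theta3_split t0).2.
have := theta3_gt0 t40; have := theta2_gt0 t40 => h2 h3.
by rewrite ler_norml; apply/andP; split; lra.
Qed.

Lemma tparam_itv (R : realType) (t : R) : 0 < t -> 0 <= tparam t <= 1.
Proof.
move=> t0; have X0 := theta3_gt0 t0.
rewrite /tparam divr_ge0 ?sqr_ge0//= ler_pdivrMr ?exprn_gt0// mul1r.
by rewrite -real_normK ?num_real// ler_sqr ?nnegrE ?theta4_le_theta3// ltW.
Qed.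

Lemma U_shaped_le (R : realType) (f : R -> R) (a b t0 t : R) :
  U_shaped f a b t0 -> a <= t <= b ->
  f t0 <= f t /\ f t <= Num.max (f a) (f b).
Proof.
move=> [/andP[at0 t0b] df fneg f0 fpos] /andP[ta tb].
have cf (x y : R) : a <= x -> y <= b -> {within `[x, y], continuous f}.
  move=> ax yb; apply: derivable_within_continuous => z; rewrite in_itv /= => /andP[xz zy].
  by apply: df; rewrite (le_trans ax) ?(le_trans zy).
have decr x y : a <= x -> x <= y -> y <= t0 -> f y <= f x.
  move=> ax xy yt0; apply: (@ler0_derive1_le_cc _ f a t0) => //.
  - by move=> z; rewrite in_itv /= => /andP[az zt]; apply: df; rewrite !ltW// (lt_le_trans zt).
  - by move=> z; rewrite in_itv /= => azt; apply: ltW; exact: fneg.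
  - exact: cf.
  - by rewrite in_itv /=; apply/andP; split; lra.
  - by rewrite in_itv /=; apply/andP; split; lra.
have incr x y : t0 <= x -> x <= y -> y <= b -> f x <= f y.
  move=> tx xy yb; apply: (@ger0_derive1_le_cc _ f t0 b) => //.
  - by move=> z; rewrite in_itv /= => /andP[tz zb]; apply: df; rewrite !ltW// (le_lt_trans at0).
  - by move=> z; rewrite in_itv /= => /andP[tz zb]; apply: ltW; apply: fpos; rewrite tz ltW.
  - exact: cf.
  - by rewrite in_itv /=; apply/andP; split; lra.
  - by rewrite in_itv /=; apply/andP; split; lra.
rewrite le_max; have [tt0|/ltW tt0] := leP t t0.
  by rewrite (decr t t0) ?(decr a t).
by rewrite (incr t0 t) ?(incr t b) ?orbT.
Qed.

Theorem theorem2 (R : realType) (n : nat) (L : set 'rV[R]_n)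
    (m : 'I_(n %/ 8).+1 -> rat)
    (hL : unimodular_lattice L)
    (hm1 : \sum_(r < (n %/ 8).+1) m r = 1)
    (hm : forall tau : R, 0 < tau ->
      theta_ratio L tau =
        \sum_(r < (n %/ 8).+1) ratr (m r) * hpoly (tparam tau) ^+ r)
    (hU : U_shaped (@f_of_coeffs R _ m) 0 1 (1 / Num.sqrt 2)) :
  (forall tau : R, 0 < tau -> theta_ratio L 1 <= theta_ratio L tau) /\
  (forall tau : R, 0 < tau ->
    theta3 tau ^+ n * (\sum_(r < (n %/ 8).+1) ratr (m r) * (3 / 4) ^+ r)
      <= lattice_theta L tau
    /\ lattice_theta L tau <= theta3 tau ^+ n).
Proof.
have ratioE t : 0 < t -> theta_ratio L t = f_of_coeffs m (tparam t) by exact: hm.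
have end1 (t : R) : hpoly t = 1 -> f_of_coeffs m t = 1.
  move=> ht; rewrite /f_of_coeffs ht -[RHS](rmorph1 (@ratr R)) -hm1 rmorph_sum /=.
  by apply: eq_bigr => r _; rewrite expr1n mulr1.
have bnd t : 0 < t -> f_of_coeffs m (1 / Num.sqrt 2 : R) <= theta_ratio L t <= 1.
  move=> t0; have [lo hi] := U_shaped_le hU (tparam_itv t0).
  rewrite ratioE// lo (le_trans hi)// !end1 ?maxxx//.
    by rewrite /hpoly !expr1n subrr add0r.
  by rewrite /hpoly !expr0n /= subrr add0r.
have h34 : hpoly (1 / Num.sqrt 2 : R) = 3 / 4.
  rewrite /hpoly (exprM _ 2 2) expr_div_n expr1n sqr_sqrtr//.
  by field.
split=> t t0.
  by rewrite ratioE// tparam1; have /andP[] := bnd t t0.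
have X0 : 0 < theta3 t ^+ n by rewrite exprn_gt0// theta3_gt0.
have -> : lattice_theta L t = theta3 t ^+ n * theta_ratio L t.
  by rewrite /theta_ratio Zlattice_theta// mulrC divfK// gt_eqF.
have /andP[] := bnd t t0; rewrite {1}/f_of_coeffs h34 => lo hi.
by rewrite ler_pM2l// lo ger_pMr.
Qed.
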